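(* For all integers $d,k\ge 1$ and every real $\delta>0$ there exists a constant $\alpha=\alpha(d,\delta,k)>0$ such that the following holds. Let $n\ge k$, let $P$ be a sequence of $n$ points in general position in $\mathbb{R}^d$, and let $\rho$ be a sequence of $k$ points in general position in $\mathbb{R}^d$. Suppose that there exist pairwise disjoint subsets $X_1,\dots,X_k$ of (the set of points of) $P$ such that: (i) $(X_1,\dots,X_k)$ has $\rho$-type transversals; and (ii) there exist at least $\delta\binom{n}{k}$ transversals to $(X_1,\dots,X_k)$ that are subsequences of $P$. Then there exist subsets $Y_1\subset X_1,\dots,Y_k\subset X_k$ such that: (a) each $Y_i$ has at least $\alpha\cdot n$ points; and (b) $(Y_1,\dots,Y_k)$ has $\rho$-type transversals with respect to $P$.
   Context: A set (or sequence) of points in $\mathbb{R}^d$ is in general position if no $j\le d+1$ of them lie in a common $(j-2)$-flat (in particular the points are distinct). The orientation of a $(d+1)$-tuple of points is $\chi(p_1,\dots,p_{d+1})=\operatorname{sgn}\det M$, where $M$ is the $(d+1)\times(d+1)$ matrix whose $i$-th row is $(1,p_i(1),\dots,p_i(d))$, with $p_i(j)$ the $j$-th coordinate of $p_i$. Two sequences $\sigma,\tau$ of $k$ points have the same labelled order type, $\sigma\simeq\tau$, if $\chi(\sigma(i_1),\dots,\sigma(i_{d+1}))=\chi(\tau(i_1),\dots,\tau(i_{d+1}))$ for all $1\le i_1<\cdots<i_{d+1}\le k$, where $\sigma(i)$ is the $i$-th entry of $\sigma$. A transversal to $(X_1,\dots,X_k)$ is a sequence $(x_1,\dots,x_k)$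 with $x_i\in X_i$ for every $i$. It is a subsequence of $P$ if the positions of $x_1,\dots,x_k$ in $P$ are strictly increasing. $(X_1,\dots,X_k)$ has $\rho$-type transversals if every transversal $\tau$ to it satisfies $\tau\simeq\rho$; it has $\rho$-type transversals with respect to $P$ if, in addition, every transversal is a subsequence of $P$. (No coloring is involved here.) *)

(* Defs.v *)
From mathcomp Require Import all_boot all_order all_algebra.
From mathcomp Require Import finmap reals.

Set Implicit Arguments.
Unset Strict Implicit.
Unset Printing Implicit Defensive.

Import Order.TTheory GRing.Theory Num.Theory.
Local Open Scope ring_scope.
Local Open Scope fset_scope.

Definition flat (R : realType) (d m : nat) (F : pred 'rV[R]_d) : Prop :=
  exists (a : 'rV[R]_d) (U : {vspace 'rV[R]_d}),
    \dim U = m /\ forall x, F x = (x - a \in U).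

(* The case j = 1 is omitted: a (-1)-flat is empty, so it contains no point.
   The j entries are taken at distinct positions, hence j = 2 (a 0-flat is a
   single point) says that the entries of [s] are pairwise distinct. *)
Definition general_position (R : realType) (d n : nat)
    (s : n.-tuple 'rV[R]_d) : Prop :=
  forall (j : nat) (i : 'I_j -> 'I_n),
    (2 <= j <= d.+1)%N -> injective i ->
    ~ exists F : pred 'rV[R]_d, flat (j - 2) F /\ forall a, F (tnth s (i a)).

Definition orientation (R : realType) (d : nat)
    (p : 'I_d.+1 -> 'rV[R]_d) : R :=
  Num.sg (\det (\matrix_(i < d.+1) row_mx (const_mx 1 : 'rV[R]_1) (p i))).

Definition same_order_type (R : realType) (d k : nat)
    (s t : k.-tuple 'rV[R]_d) : Prop :=
  forall i : 'I_d.+1 -> 'I_k, {homo i : a b / (a < b)%N} ->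
    orientation (fun a => tnth s (i a)) = orientation (fun a => tnth t (i a)).

Definition transversal_to (R : realType) (d k : nat)
    (X : 'I_k -> {fset 'rV[R]_d}) (t : k.-tuple 'rV[R]_d) : Prop :=
  forall i, tnth t i \in X i.

Definition has_type_transversals (R : realType) (d k : nat)
    (rho : k.-tuple 'rV[R]_d) (X : 'I_k -> {fset 'rV[R]_d}) : Prop :=
  forall t, transversal_to X t -> same_order_type t rho.

(* [P] is meant to be in general position, hence duplicate-free: [subseq t P]
   then says that the positions in [P] of the entries of [t] increase. *)
Definition has_type_transversals_wrt (R : realType) (d k n : nat)
    (P : n.-tuple 'rV[R]_d) (rho : k.-tuple 'rV[R]_d)
    (X : 'I_k -> {fset 'rV[R]_d}) : Prop :=
  has_type_transversals rho X /\ forall t, transversal_to X t -> subseq t P.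

(* Main.v *)
(* Only the positions of the points in [P] matter, since [rho]-type transversals
   are inherited by subsets.  Let [m] be slightly smaller than the wanted size.
   Cut [P] greedily: stop the first block as soon as it contains [m + 1] points
   of [X_1], then the second one as soon as it contains [m + 1] points of [X_2],
   and so on.  If all [k] blocks get completed, the points of [X_i] in the [i]-th
   block form [Y_i].  If the search for the [i]-th block fails, every increasing
   transversal has, for some [j <= i], its [j]-th entry among [m] fixed points,
   so there are at most [k m n^(k-1)] of them, which is less than
   [delta 'C(n, k) >= delta (n / k)^k]. *)
Require Import Defs.
From mathcomp Require Import all_boot all_order all_algebra.
From mathcomp Require Import finmap reals.
From mathcomp Require Import zify.

Set Implicit Arguments.
Unset Strict Implicit.
Unset Printing Implicit Defensive.

Import Order.TTheory GRing.Theory Num.Theory.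
Local Open Scope ring_scope.
Local Open Scope fset_scope.

(* Subsequences of [s] whose [i]-th entry satisfies the [i]-th predicate. *)
Fixpoint transversals {T : Type} (Xs : seq (pred T)) (s : seq T) :
    seq (seq T) :=
  match Xs with
  | [::] => [:: [::]]
  | X :: Xs' =>
    (fix aux (s : seq T) : seq (seq T) :=
       match s with
       | [::] => [::]
       | x :: s' =>
         (if X x then [seq x :: t | t <- transversals Xs' s'] else [::])
           ++ aux s'
       end) s
  end.

Lemma mem_transversals (T : eqType) (Xs : seq (pred T)) (s t : seq T) :
  subseq t s -> all2 (fun (X : pred T) x => X x) Xs t ->
  t \in transversals Xs s.
Proof.
elim: Xs s t => [|X Xs IH] s [|y t] //; elim: s => [|x s IHs] //= sub_ts.
move=> /andP[Xy Xst]; rewrite mem_cat.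
case: eqP sub_ts => [<-|_] sub_ts.
  by rewrite Xy map_f //; exact: IH.
by apply/orP; right; apply: IHs; rewrite //= Xy.
Qed.

Lemma size_transversals_cons (T : Type) (X : pred T) (Xs : seq (pred T)) x s :
  size (transversals (X :: Xs) (x :: s)) =
    (X x * size (transversals Xs s) + size (transversals (X :: Xs) s))%N.
Proof. by rewrite /= size_cat; case: (X x); rewrite ?size_map ?mul1n. Qed.

(** The head is one of the [size s] entries, and the tail is a transversal of a suffix of [s], hence
    of [s]. *)
Lemma leq_size_transversals_head (T : Type) (X : pred T) (Xs : seq (pred T)) s :
  (size (transversals (X :: Xs) s) <= size s * size (transversals Xs s))%N.
Proof.
elim: s => // x s IH; rewrite size_transversals_cons.
have mono : (size (transversals Xs s) <= size (transversals Xs (x :: s)))%N.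
  by case: (Xs) => // Z Zs; rewrite size_transversals_cons leq_addl.
rewrite mulSn; apply: leq_add.
  by case: (X x); rewrite ?mul1n.
by apply: (leq_trans IH); rewrite leq_mul2l mono orbT.
Qed.

Lemma leq_size_transversals (T : Type) (Xs : seq (pred T)) s :
  (size (transversals Xs s) <= size s ^ size Xs)%N.
Proof.
elim: Xs => // X Xs IH; rewrite [size (X :: _)]/= expnS.
by apply: leq_trans (leq_size_transversals_head _ _ _) _; rewrite leq_mul2l IH orbT.
Qed.

(** Outer induction on [Xs], inner induction on [s]. The bound [n] stays fixed while [s] shrinks, so
    the outer hypothesis applies to whatever follows a completed block; [v] is the part left
    over. *)
Lemma greedy_blocks (T : Type) (m n : nat) (Xs : seq (pred T)) (s : seq T) :
  (size s <= n)%N ->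
  (exists2 ss, all2 (fun X u => (m < count X u)%N) Xs ss &
               exists v, s = flatten ss ++ v) \/
  (size (transversals Xs s) <= size Xs * m * n ^ (size Xs).-1)%N.
Proof.
elim: Xs s => [|X Xs IH] s le_sn.
  by left; exists [::] => //; exists s.
pose k := size Xs.
(* [c] is the number of points that the first block may still miss. *)
suff block c : (exists u ss v,
      [/\ all2 (fun X u => (m < count X u)%N) Xs ss, (c < count X u)%N
        & s = u ++ flatten ss ++ v]) \/
    (size (transversals (X :: Xs) s) <= c * n ^ k + k * m * n ^ k)%N.
  case: (block m) => [[u [ss [v [ss_m lt_mu s_eq]]]]|le_N].
    left; exists (u :: ss); first by rewrite /= lt_mu.
    by exists v; rewrite /= -catA.
  by right; rewrite [size (X :: Xs)]/= mulSn mulnDl.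
elim: s le_sn c => [|x s IHs] le_sn c; first by right.
rewrite size_transversals_cons.
have le_s : (size s <= n)%N by exact: ltnW.
have [Xx|nXx] := boolP (X x); last first.
  case: (IHs le_s c) => [[u [ss [v [ss_m lt_cu ->]]]]|le_N].
    by left; exists (x :: u), ss, v; rewrite /= (negbTE nXx).
  by right; rewrite mul0n.
(* For [c = 0] the point [x] completes the block. If the later blocks then fail in [s], few tails
   exist there, and each tail has at most [n] possible heads. *)
case: c => [|c].
  case: (IH s le_s) => [[ss ss_m [v ->]]|le_N].
    by left; exists [:: x], ss, v; rewrite /= Xx.
  right; rewrite mul1n mul0n add0n.
  apply: (@leq_trans (n * size (transversals Xs s))).
    apply: leq_trans (leq_mul le_sn (leqnn _)).
    by rewrite mulSn leq_add2l leq_size_transversals_head.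
  apply: leq_trans (leq_mul (leqnn n) le_N) _; rewrite -/k.
  (* For [k = 0] both sides vanish; otherwise the factor [n] restores the exponent lowered by
     [.-1]. *)
  by case: (k) => [|j] /=; rewrite ?mul0n ?muln0 // expnS mulnCA.
case: (IHs le_s c) => [[u [ss [v [ss_m lt_cu ->]]]]|le_N].
  by left; exists (x :: u), ss, v; rewrite /= Xx.
(* The transversals headed by [x] number at most [n ^ k], which pays for lowering [c] by one. *)
right; rewrite mul1n mulSn -addnA leq_add //.
apply: leq_trans (leq_size_transversals _ _) _.
by rewrite -/k; case: (k) => // j; rewrite leq_exp2r.
Qed.

Lemma subseq_flatten (T : eqType) (t : seq T) (ss : seq (seq T)) :
  all2 (fun x u => x \in u) t ss -> subseq t (flatten ss).
Proof.
elim: t ss => [|x t IH] [|u ss] //= /andP[xu /IH sub_t].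
by rewrite -cat1s cat_subseq // sub1seq.
Qed.

(** After multiplication by [k!], both sides are products over [i < k], compared factor by factor:
    [n * (k - i) <= k * (n - i)]. *)
Lemma leq_expn_bin (n k : nat) : (k <= n)%N -> (n ^ k <= k ^ k * 'C(n, k))%N.
Proof.
move=> le_kn; rewrite -(leq_pmul2r (fact_gt0 k)) -mulnA bin_ffact -ffactnn.
have prodc c : (c ^ k = \prod_(i < k) c)%N by rewrite prod_nat_const card_ord.
rewrite !ffact_prod !prodc -!big_split /=.
apply: leq_prod => i _; have := ltn_ord i; nia.
Qed.

Lemma general_position_uniq (R : realType) (d n : nat)
    (P : n.-tuple 'rV[R]_d) : (1 <= d)%N -> general_position P -> uniq P.
Proof.
move=> d_gt0 gpP; apply/tuple_uniqP => a b eq_ab; apply/eqP.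
apply: contraT => neq_ab; exfalso.
pose i (c : 'I_2) := if c == ord0 then a else b.
apply: (gpP 2 i) => //.
  rewrite /i => c e; case: c => -[|[|]] //= ?; case: e => -[|[|]] //= ?;
    by [move=> _; apply/val_inj | move=> eqab; rewrite eqab eqxx in neq_ab].
exists (pred1 (tnth P a)); split.
  exists (tnth P a), 0%VS; split; first by rewrite dimv0.
  by move=> x /=; rewrite memv0 subr_eq0.
by move=> c; rewrite /i /=; case: ifP => _; rewrite ?eq_ab.
Qed.

Theorem lemma5 (R : realType) (d k : nat) (delta : R) :
  (1 <= d)%N -> (1 <= k)%N -> 0 < delta ->
  exists2 alpha : R, 0 < alpha &
    forall (n : nat) (P : n.-tuple 'rV[R]_d) (rho : k.-tuple 'rV[R]_d)
           (X : 'I_k -> {fset 'rV[R]_d}),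
      (k <= n)%N ->
      general_position P ->
      general_position rho ->
      (forall i, {subset X i <= P}) ->
      (forall i j, i != j -> [disjoint X i & X j]) ->
      has_type_transversals rho X ->
      (exists T : {fset k.-tuple 'rV[R]_d},
         (forall t, t \in T -> transversal_to X t /\ subseq t P) /\
         delta * 'C(n, k)%:R <= #|` T|%:R) ->
      exists Y : 'I_k -> {fset 'rV[R]_d},
        (forall i, Y i `<=` X i) /\
        (forall i, alpha * n%:R <= #|` Y i|%:R) /\
        has_type_transversals_wrt P rho Y.
Proof.
move=> d_gt0 k_gt0 delta_gt0.
have kk_gt0 : 0 < (k.+1 * k ^ k)%:R :> R by rewrite ltr0n muln_gt0 expn_gt0 k_gt0.
(* The factor [k ^ k] comes from comparing [n ^ k] with ['C(n, k)]; [k.+1] in place of [k] makes the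
   final contradiction strict. *)
exists (delta / (k.+1 * k ^ k)%:R); first exact: divr_gt0.
set alpha := _ / _ => n P rho X le_kn gpP _ _ _ rhoX [T [T_tr leT]].
have alpha_gt0 : 0 < alpha by exact: divr_gt0.
have delta_eq : delta = alpha * (k.+1 * k ^ k)%:R by rewrite divfK // gt_eqF.
clearbody alpha.
have uniqP := general_position_uniq d_gt0 gpP.
have n_gt0 : (0 < n)%N by exact: leq_trans le_kn.
(* With [m] the integer part of [alpha * n], more than [m] points means at least [alpha * n], while
   [m <= alpha * n] serves the counting case. *)
have /andP[le_m lt_m] := truncn_itv (mulr_ge0 (ltW alpha_gt0) (ler0n R n)).
set m := Num.truncn _ in le_m lt_m.
pose Xs : seq (pred 'rV[R]_d) := [seq (fun x => x \in X i) | i <- enum 'I_k].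
have size_Xs : size Xs = k by rewrite size_map size_enum_ord.
have [[ss ss_m [v P_eq]]|le_N] := @greedy_blocks _ m n Xs P (eq_leq (size_tuple P)).
  have size_ss : size ss = k.
    by move: ss_m; rewrite all2E size_Xs => /andP[/eqP].
  have uniq_ss : uniq (flatten ss) by move: uniqP; rewrite P_eq cat_uniq => /andP[].
  pose Y (i : 'I_k) := [fset x in nth [::] ss i | x \in X i].
  have YX i : Y i `<=` X i by apply/fsubsetP => x; rewrite !inE => /andP[].
  exists Y; split=> //; split=> [i|].
    have lt_count : (m < count (mem (X i)) (nth [::] ss i))%N.
      move: ss_m; rewrite all2E => /andP[_ /(all_nthP (xpred0, [::]))/(_ i)].
      rewrite size_zip size_Xs size_ss minnn ltn_ord nth_zip ?size_Xs //=.
      by rewrite (nth_map i) ?size_enum_ord // nth_ord_enum; apply.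
    apply: ltW; apply: lt_le_trans lt_m _; rewrite ler_nat.
    apply: leq_trans lt_count _; rewrite -size_filter.
    (* [count] sees multiplicities and the cardinal of [Y i] does not; they agree because each block
       inherits [uniq] from [P]. *)
    apply: uniq_leq_size => [|x]; last first.
      by rewrite mem_filter !inE andbC.
    apply: filter_uniq; apply: (subseq_uniq _ uniq_ss).
    rewrite -{2}(cat_take_drop i ss) (drop_nth [::]) ?size_ss //.
    rewrite flatten_cat /=.
    exact: subseq_trans (prefix_subseq _ _) (suffix_subseq _ _).
  split=> [t tY|t tY]; first by apply: rhoX => i; apply: (fsubsetP (YX i)).
  rewrite P_eq; apply: subseq_trans (prefix_subseq _ _).
  apply: subseq_flatten; rewrite all2E size_tuple size_ss eqxx /=.
  apply/(all_nthP (0, [::])) => i.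
  rewrite size_zip size_tuple size_ss minnn => lt_ik.
  rewrite nth_zip ?size_tuple //=.
  have := tY (Ordinal lt_ik); rewrite (tnth_nth 0) !inE /=.
  by case/andP.
have le_T : (#|` T| <= k * m * n ^ k.-1)%N.
  rewrite -[in X in (_ <= X)%N]size_Xs; apply: leq_trans le_N.
  rewrite -(size_map val); apply: uniq_leq_size.
    by rewrite map_inj_uniq ?fset_uniq //; exact: val_inj.
  move=> _ /mapP[t /T_tr[tX sub_tP] ->]; apply: mem_transversals => //.
  rewrite all2E size_Xs size_tuple eqxx /=.
  apply/(all_nthP (xpred0, 0)) => i.
  rewrite size_zip size_Xs size_tuple minnn => lt_ik.
  rewrite nth_zip ?size_Xs ?size_tuple //=.
  rewrite (nth_map (Ordinal lt_ik)) ?size_enum_ord //.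
  rewrite -[i]/(val (Ordinal lt_ik)) nth_ord_enum -tnth_nth; exact: tX.
suff : (#|` T|%:R : R) < delta * 'C(n, k)%:R by rewrite ltNge leT.
rewrite delta_eq.
apply: (@le_lt_trans _ _ (alpha * (k * n ^ k)%:R)).
  apply: (@le_trans _ _ (k * m * n ^ k.-1)%:R); first by rewrite ler_nat.
  have -> : (n ^ k = n * n ^ k.-1)%N by rewrite -expnS prednK.
  rewrite !natrM.
  rewrite (mulrC k%:R m%:R) -mulrA.
  rewrite [leRHS](_ : _ = alpha * n%:R * (k%:R * (n ^ k.-1)%:R)); last first.
    by rewrite (mulrCA k%:R) !mulrA.
  by rewrite ler_wpM2r // mulr_ge0.
(* What remains is [k * n ^ k < k.+1 * n ^ k <= k.+1 * k ^ k * 'C(n, k)], strict since [n ^ k] is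
   positive. *)
rewrite -mulrA (ltr_pM2l alpha_gt0) -natrM ltr_nat -mulnA.
have := leq_expn_bin le_kn; have : (0 < n ^ k)%N by rewrite expn_gt0 n_gt0.
nia.
Qed.
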